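(* Let $M,m,n$ be integers with $0\le m<M\le n$. The collection of arcs $\mathcal{A}_{\max}$ (for the parameters $M,m,n$) maximizes the edge count among all collections of arcs satisfying conditions $M,m,n$.
   Context: A circular arc is a closed connected arc $[x,y]$ on a fixed circle, traversed clockwise from its left endpoint $x$ to its right endpoint $y$ (with $x\ne y$, so it is not the whole circle). All $2n$ endpoints of a collection of $n$ arcs are assumed pairwise distinct. For a point $p$ on the circle, the agreement number $a(p)$ is the number of arcs of the collection containing $p$. A collection satisfies conditions $M,m,n$ if it consists of $n$ arcs, $\max_p a(p)=M$ and $\min_p a(p)=m$. The edge count of a collection is the number of unordered pairs of its arcs that intersect. Definition of $\mathcal{A}_{\max}$: place $2n$ distinct points on the circle and label them, in clockwise order from a starting point, by the sequence consisting of $M-m$ symbols $L$, then the pair $R,L$ repeated $n-M+m$ times, then $M-m$ symbols $R$. Let $L_1,\dots,L_n$ be the points labelled $L$ and $R_1,\dots,R_n$ those labelled $R$, each numbered in clockwise order from the starting point. $\mathcal{A}_{\max}$ consists of the $n$ arcs $A_1,\dots,A_m,B_{m+1},\dots,B_n$, where $A_i$ ($1\le i\le m$) has left endpoint $L_{n-m+i}$ and right endpoint $R_i$ (so it runs clockwise from $L_{n-m+i}$, past the end of the sequence and through the starting point, to $R_i$), and $B_{m+i}$ ($1\le i\le n-m$) has left endpoint $L_i$ and right endpoint $R_{m+i}$. *)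

(* Defs.v *)
From mathcomp Require Import all_boot all_order all_algebra.
From mathcomp Require Import boolp reals.

Set Implicit Arguments.
Unset Strict Implicit.
Unset Printing Implicit Defensive.

Import Order.TTheory GRing.Theory Num.Theory.
Local Open Scope ring_scope.

(* The circle is R/Z, each point being given by its unique representative in
   [0, 1); clockwise is the direction of increasing parameter. *)
Definition circle (R : realType) := {t : R | (0 <= t) && (t < 1)}.

(* Length of the clockwise path from x to y, the circle having length 1. *)
Definition cwdist (R : realType) (x y : circle R) : R :=
  if val x <= val y then val y - val x else 1 + (val y - val x).

(* An arc [x, y] is given by its (left, right) endpoints.  The requirement
   x != y is part of the pairwise distinctness of the endpoints of a
   collection, see [satisfies]. *)
Definition arc (R : realType) := (circle R * circle R)%type.

Definition in_arc (R : realType) (a : arc R) (p : circle R) : bool :=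
  cwdist a.1 p <= cwdist a.1 a.2.

Definition intersect (R : realType) (a b : arc R) : Prop :=
  exists p : circle R, in_arc a p /\ in_arc b p.

Definition collection (R : realType) (n : nat) := 'I_n -> arc R.

Definition endpoints (R : realType) (n : nat) (A : collection R n) :
    seq (circle R) :=
  [seq (A i).1 | i <- enum 'I_n] ++ [seq (A i).2 | i <- enum 'I_n].

Definition agreement (R : realType) (n : nat) (A : collection R n)
    (p : circle R) : nat :=
  #|[set i : 'I_n | in_arc (A i) p]|.

Definition satisfies (R : realType) (M m n : nat) (A : collection R n) : Prop :=
  [/\ uniq (endpoints A),
      (forall p, (agreement A p <= M)%N) /\ (exists p, agreement A p = M)
    & (forall p, (m <= agreement A p)%N) /\ (exists p, agreement A p = m)].

Definition edge_count (R : realType) (n : nat) (A : collection R n) : nat :=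
  #|[set ij : 'I_n * 'I_n |
      (ij.1 < ij.2)%N && `[< intersect (A ij.1) (A ij.2) >]]|.

(* [true] stands for the symbol L and [false] for R. *)
Definition amax_word (M m n : nat) : seq bool :=
  nseq (M - m) true
  ++ flatten (nseq (n - M + m) [:: false; true])
  ++ nseq (M - m) false.

(* The points are distinct and listed in clockwise order from s; s itself may
   only occur as the first of them. *)
Definition clockwise_from (R : realType) (s : circle R)
    (pts : seq (circle R)) : Prop :=
  sorted (fun p q => cwdist s p < cwdist s q) pts.

(* All numberings are shifted to start from 0: with i < n, the arc of index i
   is A_{i+1} = [L_{n-m+i+1}, R_{i+1}] if i < m, and
   B_{i+1} = [L_{i+1-m}, R_{i+1}] otherwise.  The default s of [nth] is never
   used when m < M <= n. *)
Definition amax (R : realType) (M m n : nat) (s : circle R)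
    (pts : (n.*2).-tuple (circle R)) : collection R n :=
  let Ls := mask (amax_word M m n) pts in
  let Rs := mask (map negb (amax_word M m n)) pts in
  fun i : 'I_n =>
    if (i < m)%N then (nth s Ls (n - m + i), nth s Rs i)
    else (nth s Ls (i - m), nth s Rs i).

(* Main.v *)
Require Import Defs.
From mathcomp Require Import all_boot all_order all_algebra.
From mathcomp Require Import boolp reals.
From mathcomp Require Import zify lra.

(* If two arcs meet, the left endpoint of one lies in the other.  Cut the
   circle at a point p of agreement m, and let P be the m arcs through p.  The
   other arcs do not wrap around p; the k-th of them (from 0), by left
   endpoint, has its left endpoint in at most min(M-1, k) others of them, and
   in at most min(M-1, m+k) other arcs.  Charging every edge to such a left
   endpoint gives two bounds on the number of edges:
     m(M-1) + sum_(k < n-m) min(M-1, m+k), and, granting all edges at P,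
     C(m,2) + sum_(k < n-m) (m + min(M-1, k)).
   A_max attains the first when 2M <= n and the second when n < 2M. *)

Set Implicit Arguments.
Unset Strict Implicit.
Unset Printing Implicit Defensive.

Import Order.TTheory GRing.Theory Num.Theory.

(** * Clockwise distance as a linear coordinate, and arcs read in it *)

Section Geo.
Variable R : realType.
Implicit Types (s p x y : circle R) (a b : Defs.arc R).
Local Open Scope ring_scope.

Lemma cwdist_ge0 s x : 0 <= cwdist s x.
Proof.
rewrite /cwdist; case: s x => [s hs] [x hx] /=.
by move/andP: hs => [? ?]; move/andP: hx => [? ?]; case: (leP s x) => ?; lra.
Qed.

Lemma cwdist_lt1 s x : cwdist s x < 1.
Proof.
rewrite /cwdist; case: s x => [s hs] [x hx] /=.
by move/andP: hs => [? ?]; move/andP: hx => [? ?]; case: (leP s x) => ?; lra.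
Qed.

Lemma cwdistxx s : cwdist s s = 0.
Proof. by rewrite /cwdist lexx subrr. Qed.

Lemma cwdist_inj s : injective (cwdist s).
Proof.
move=> x y; rewrite /cwdist => h; apply: val_inj; move: h.
case: s x y => [s hs] [x hx] [y hy] /=.
move/andP: hs => [? ?]; move/andP: hx => [? ?]; move/andP: hy => [? ?].
by case: (leP s x) => ?; case: (leP s y) => ?; lra.
Qed.

Lemma cwdist_surj s (v : R) : 0 <= v < 1 -> exists p, cwdist s p = v.
Proof.
move=> /andP[v0 v1]; case: s => [s hs]; move/andP: (hs) => [s0 s1].
case: (ltP (s + v) 1) => h.
  have hp : (0 <= s + v) && (s + v < 1) by apply/andP; split; lra.
  exists (exist (fun t : R => (0 <= t) && (t < 1)) _ hp); rewrite /cwdist /=.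
  by case: (leP s (s + v)) => ?; lra.
have hp : (0 <= s + v - 1) && (s + v - 1 < 1) by apply/andP; split; lra.
exists (exist (fun t : R => (0 <= t) && (t < 1)) _ hp); rewrite /cwdist /=.
by case: (leP s (s + v - 1)) => ?; lra.
Qed.

Lemma cwdist_rot s x y : cwdist x y =
  if cwdist s x <= cwdist s y then cwdist s y - cwdist s x
  else 1 + (cwdist s y - cwdist s x).
Proof.
rewrite /cwdist; case: s x y => [s hs] [x hx] [y hy] /=.
move/andP: hs => [? ?]; move/andP: hx => [? ?]; move/andP: hy => [? ?].
case: (leP s x) => ?; case: (leP s y) => ?; case: (leP x y) => ?;
  by case: leP => ?; lra.
Qed.

(** Cutting the circle at an arbitrary s reduces membership to order comparisons in the coordinate
    [cwdist s]; the second branch is that of an arc wrapping around s. *)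
Lemma in_arcE s a p : in_arc a p =
  let u := cwdist s in
  if u a.1 <= u a.2 then u a.1 <= u p <= u a.2
  else (u a.1 <= u p) || (u p <= u a.2).
Proof.
rewrite /in_arc /= (cwdist_rot s a.1 p) (cwdist_rot s a.1 a.2).
move: (cwdist_ge0 s a.1) (cwdist_ge0 s a.2) (cwdist_ge0 s p).
move: (cwdist_lt1 s a.1) (cwdist_lt1 s a.2) (cwdist_lt1 s p).
move: (cwdist s a.1) (cwdist s a.2) (cwdist s p) => x y z ? ? ? ? ? ?.
case: (leP x y) => ?; case: (leP x z) => ? /=; first by rewrite lerD2r.
- by apply/negbTE; rewrite -ltNge; lra.
- by lra.
- by rewrite !lerD2l lerBlDr subrK.
Qed.

Lemma in_arc_left a : in_arc a a.1.
Proof. by rewrite /in_arc cwdistxx cwdist_ge0. Qed.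

(** Cut at [a.1], so that a starts at coordinate 0. If [b.1] comes no later than the common point q,
    it lies in a; otherwise b wraps around the cut and hence contains [a.1]. *)
Lemma intersect_left a b : intersect a b -> in_arc a b.1 || in_arc b a.1.
Proof.
case=> q []; rewrite !(in_arcE a.1) /= cwdistxx !cwdist_ge0 /= => qa.
case: (leP (cwdist a.1 b.1)) => hb /=.
  by case/andP=> h1 _; rewrite (le_trans h1 qa).
case/orP=> [h1|_]; first by rewrite (le_trans h1 qa).
by rewrite !orbT.
Qed.

(* Walking from s to p, an arc is entered at its left endpoint and left just
   after its right one; it is open at the start iff it wraps around s. *)
Lemma in_arc_balance s a p :
  (in_arc a p + (cwdist s a.2 < cwdist s p)%R =
   (cwdist s a.2 < cwdist s a.1)%R + (cwdist s a.1 <= cwdist s p)%R)%N.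
Proof.
rewrite (in_arcE s) /=.
move: (cwdist s a.1) (cwdist s a.2) (cwdist s p) => x y z.
case: (leP x y) => hxy /=.
  case: (leP x z) => hxz; case: (leP z y) => hzy //=.
  by move: (lt_le_trans hxz hxy); rewrite ltNge (ltW hzy).
case: (leP x z) => hxz; case: (leP z y) => hzy //=.
by move: (le_lt_trans hzy hxy); rewrite ltNge hxz.
Qed.

(** After summation, the matching of left with right endpoints matters only through the number of
    arcs that wrap around s. *)
Lemma agreement_balance n (A : collection R n) s p :
  (agreement A p + \sum_(i < n) (cwdist s (A i).2 < cwdist s p)%R =
   \sum_(i < n) (cwdist s (A i).2 < cwdist s (A i).1)%R +
   \sum_(i < n) (cwdist s (A i).1 <= cwdist s p)%R)%N.
Proof.
rewrite /agreement -sum1_card big_mkcond -!big_split /=.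
apply: eq_bigr => i _; rewrite -in_arc_balance inE.
by case: (in_arc _ _).
Qed.

End Geo.

(** * Counting by ranks and by oriented pairs *)

(** By injectivity the ranks in Q are 0, ..., #|Q| - 1, each taken once. The induction removes the
    element with the largest value of f: it has the top rank, and the other ranks do not change. *)
Lemma sum_rank d (T : finType) (K : orderType d) (f : T -> K) (Q : {set T})
    (F : nat -> nat) : {in Q &, injective f} ->
  \sum_(j in Q) F #|[set i in Q | (f i < f j)%O]| = \sum_(k < #|Q|) F k.
Proof.
elim: {Q}_.+1 {-2}Q (ltnSn #|Q|) => // N IH Q leQN injf.
have [->|[x0 Qx0]] := set_0Vmem Q; first by rewrite big_set0 cards0 big_ord0.
have [x Qx xmax] : exists2 x, x \in Q & forall i, i \in Q -> (f i <= f x)%O.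
  by case: (arg_maxP f Qx0) => x Qx xmax; exists x.
have cQ : #|Q| = #|Q :\ x|.+1 by rewrite (cardsD1 x) Qx.
rewrite cQ big_ord_recr /= (big_setD1 x) //= addnC; congr (_ + F _).
- rewrite -IH; first last.
  + by move=> i j /setD1P[_ Qi] /setD1P[_ Qj]; apply: injf.
  + by rewrite -ltnS -cQ.
  apply: eq_bigr => j /setD1P[_ Qj]; congr (F #|pred_of_set _|).
  apply/setP=> i; rewrite !inE; case: eqP => //= ->.
  by rewrite Qx /=; apply/negbTE; rewrite -leNgt; apply: xmax.
- apply: eq_card => i; rewrite !inE andbC; case Qi: (i \in Q); last by rewrite !andbF.
  rewrite !andbT lt_neqAle [(_ <= _)%O]xmax // andbT.
  by congr negb; apply/eqP/eqP => [|->//]; apply: injf.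
Qed.

Lemma card_pairs_sum (T : finType) (D : rel T) :
  #|[set ij : T * T | D ij.1 ij.2]| = \sum_i #|[set j | D i j]|.
Proof.
rewrite -sum1_card (eq_bigl (fun ij => predT ij.1 && D ij.1 ij.2)); last first.
  by move=> ij; rewrite inE.
rewrite -(pair_big_dep predT D (fun _ _ => 1)) /=.
by apply: eq_bigr => i _; rewrite -sum1_card; apply: eq_bigl => j; rewrite inE.
Qed.

Lemma card_swap (T : finType) (D : rel T) :
  #|[set ij : T * T | D ij.2 ij.1]| = #|[set ij : T * T | D ij.1 ij.2]|.
Proof.
rewrite (card_pairs_sum D) (card_pairs_sum (fun i j => D j i)).
transitivity (\sum_i \sum_j if D j i then 1 else 0).
  apply: eq_bigr => i _; rewrite -sum1_card [LHS]big_mkcond.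
  by apply: eq_bigr => j _; rewrite inE.
rewrite exchange_big /=; apply: eq_bigr => i _.
by rewrite -sum1_card [RHS]big_mkcond; apply: eq_bigr => j _; rewrite !inE.
Qed.

(** Every edge is oriented by D in at least one direction. Edges oriented against the index order
    ([S']) are reversed into [S''], which is disjoint from [S], so the two together inject into the
    pairs of D. *)
Lemma card_pairs_orient n (E D : rel 'I_n) :
    (forall i j, i != j -> E i j -> D i j || D j i) ->
  #|[set ij : 'I_n * 'I_n | (ij.1 < ij.2) && E ij.1 ij.2]| <=
  \sum_j #|[set i | (i != j) && D i j]|.
Proof.
move=> ED; pose S := [set ij : 'I_n * 'I_n | (ij.1 < ij.2) && D ij.1 ij.2].
pose S' := [set ij : 'I_n * 'I_n | (ij.1 < ij.2) && D ij.2 ij.1].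
pose S'' := [set ij : 'I_n * 'I_n | (ij.2 < ij.1) && D ij.1 ij.2].
have S'E : #|S'| = #|S''| by rewrite -(card_swap (fun i j : 'I_n => (j < i) && D i j)).
rewrite -(card_pairs_sum (fun j i : 'I_n => (i != j) && D i j)).
rewrite (card_swap (fun i j : 'I_n => (i != j) && D i j)).
apply: (@leq_trans #|S :|: S'|).
  apply/subset_leq_card/subsetP => -[i j]; rewrite !inE /= => /andP[ij Eij].
  by rewrite ij /= ED // neq_ltn ij.
apply: (leq_trans (leq_card_setU _ _)); rewrite S'E -cardsUI.
have -> : S :&: S'' = set0.
  by apply/setP => -[i j]; rewrite !inE /=; case: (ltngtP i j); rewrite ?andbF.
rewrite cards0 addn0; apply/subset_leq_card/subsetP => -[i j].
by rewrite !inE /= -andb_orl -neq_ltn.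
Qed.

Lemma card_ord_interval n a b : b <= n -> #|[set j : 'I_n | a <= j < b]| = b - a.
Proof.
move=> bn; rewrite -sum1_card (eq_bigl (fun j : 'I_n => a <= j < b)); last first.
  by move=> j; rewrite inE.
rewrite -(big_mkord (fun j => a <= j < b) (fun _ => 1)).
rewrite -[RHS]muln1 -sum_nat_const_nat (big_nat_widen a b n) //.
by rewrite (big_nat_widenl a 0) //; apply: eq_bigl => j; rewrite andbC.
Qed.

(** Raising m by one drops the first term, [minn c m] = m, and adds a last term of at most c: the
    gain is at most c - m. *)
Lemma sum_min_shift c m N : m <= c ->
  \sum_(k < N) minn c (m + k) <= \sum_(i < m) (c - i) + \sum_(k < N) minn c k.
Proof.
elim: m => [|m IH] mc; first by rewrite big_ord0.
have {}IH := IH (ltnW mc); rewrite big_ord_recr /=.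
(* The sum of N + 1 consecutive terms is split both at its front and at its back. *)
have := @big_ord_recl nat 0 addn N (fun k : 'I_N.+1 => minn c (m + k)).
rewrite big_ord_recr /= addn0 (minn_idPr (ltnW mc)).
under [X in _ = _ + X]eq_bigr do rewrite /bump /= addnCA add1n -addSn.
move: IH (geq_minl c (m + N)) => /[swap]; move: (minn c (m + N)) => z.
move: (\sum_(k < N) minn c (m + k)) (\sum_(k < N) minn c k) => x y.
move: (\sum_(k < N) _) (\sum_(k < m) _) => a b.
lia.
Qed.

(** * The two upper bounds on the edge count *)

Lemma satisfies_left_inj (R : realType) M m n (B : collection R n) :
  satisfies M m B -> injective (fun i => (B i).1).
Proof. by case; rewrite /endpoints cat_uniq => /andP[/injectiveP]. Qed.

(** An arc wrapping around p would contain p, and so would one starting at p. *)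
Lemma notin_arc_base (R : realType) (a : Defs.arc R) p : ~~ in_arc a p ->
  (0 < cwdist p a.1 <= cwdist p a.2)%R.
Proof.
rewrite (in_arcE p) /= cwdistxx cwdist_ge0 andbT orbT.
by case: (leP (cwdist p a.1) (cwdist p a.2)) => // _; rewrite -ltNge andbT.
Qed.

Lemma notin_arc_le_left (R : realType) (a : Defs.arc R) p x : ~~ in_arc a p ->
  in_arc a x -> (cwdist p a.1 <= cwdist p x)%R.
Proof. by move=> /notin_arc_base/andP[_ h]; rewrite (in_arcE p) /= h => /andP[]. Qed.

Section UpperBounds.
Variables (R : realType) (M m n : nat) (B : collection R n).
Hypothesis (satB : satisfies M m B).

(** Arc j is itself one of the at most M arcs through its left endpoint. *)
Lemma card_left_others j :
  #|[set i | (i != j) && in_arc (B i) (B j).1]| <= M.-1.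
Proof.
case: satB => _ [/(_ (B j).1) + _] _.
rewrite /agreement (cardsD1 j) inE in_arc_left add1n.
have -> : [set i | in_arc (B i) (B j).1] :\ j =
  [set i | (i != j) && in_arc (B i) (B j).1] by apply/setP => i; rewrite !inE.
by case: M.
Qed.

Section BasePoint.
Variable p : circle R.
Hypothesis agrp : agreement B p = m.

Let P := [set i : 'I_n | in_arc (B i) p].
Let pos i := cwdist p (B i).1.

Let cardP : #|P| = m. Proof. exact: agrp. Qed.

Let cardQ : #|~: P| = n - m.
Proof. by have := cardsC P; rewrite card_ord cardP => nE; lia. Qed.

Let pos_inj : injective pos.
Proof. by move=> i j /cwdist_inj; apply: (satisfies_left_inj satB). Qed.

Let left_lt i j : i \notin P -> i != j -> in_arc (B i) (B j).1 ->
  (pos i < pos j)%R.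
Proof.
rewrite inE lt_neqAle => iQ ij /(notin_arc_le_left iQ) ->.
by rewrite andbT; apply: contra ij => /eqP/pos_inj ->.
Qed.

Let sum_PQ F : \sum_(j < n) F j = \sum_(j in P) F j + \sum_(j in ~: P) F j.
Proof.
by rewrite (bigID (mem P)) /=; congr (_ + _); apply: eq_bigl => j; rewrite ?in_setC.
Qed.

Lemma edge_count_le_sparse :
  edge_count B <= m * M.-1 + \sum_(k < n - m) minn M.-1 (m + k).
Proof.
apply: (leq_trans (card_pairs_orient (E := fun i j => `[< intersect (B i) (B j) >])
  (D := fun i j => in_arc (B i) (B j).1) _)).
  by move=> i j _ /asboolP/intersect_left.
rewrite sum_PQ; apply: leq_add.
  by rewrite -cardP -sum_nat_const; apply: leq_sum => j _; apply: card_left_others.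
rewrite -cardQ -(sum_rank (f := pos) (fun k => minn M.-1 (m + k))); last exact: in2W.
apply: leq_sum => j jQ; rewrite leq_min card_left_others /=.
(* An arc through the left endpoint of j either belongs to P or starts before j in the order of
   [pos]: at most m plus the rank of j. *)
rewrite -cardP; apply: leq_trans (leq_card_setU _ _).
apply/subset_leq_card/subsetP => i; rewrite !inE => /andP[ij h].
by case iP: (in_arc _ p) => //=; apply: left_lt => //; rewrite inE iP.
Qed.

Lemma edge_count_le_dense :
  edge_count B <= \sum_(k < m) k + \sum_(k < n - m) (m + minn M.-1 k).
Proof.
have sumP := sum_rank (f := @nat_of_ord n) (Q := P) id (in2W val_inj).
rewrite cardP in sumP.
(* All pairs meeting P are granted: those inside P go to the larger index, giving 0 + ... + (m - 1),
   and mixed pairs go to the arc outside P. Only pairs outside P are charged to a left endpoint. *)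
apply: (leq_trans (card_pairs_orient (E := fun i j => `[< intersect (B i) (B j) >])
  (D := fun i j => if j \in P then (i \in P) && (i < j)
                   else (i \in P) || in_arc (B i) (B j).1) _)).
  move=> i j ij /asboolP/intersect_left.
  case: (boolP (i \in P)); case: (boolP (j \in P)) => //= _ _ _.
  by rewrite -neq_ltn.
rewrite sum_PQ; apply: leq_add.
  rewrite -sumP.
  apply: leq_sum => j jP; apply/subset_leq_card/subsetP => i.
  by rewrite [i \in _]inE jP [i \in [set _ in _ | _]]inE => /andP[].
rewrite -cardQ -(sum_rank (f := pos) (fun k => m + minn M.-1 k)); last exact: in2W.
apply: leq_sum => j; rewrite inE => /negbTE jP; rewrite jP.
set S := [set i in ~: P | (i != j) && in_arc (B i) (B j).1].
apply: (@leq_trans (m + #|S|)).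
  rewrite -cardP; apply: leq_trans (leq_card_setU _ _).
  apply/subset_leq_card/subsetP => i; rewrite !inE => /andP[-> /=].
  by case: (in_arc _ p).
rewrite leq_add2l leq_min; apply/andP; split.
  apply: leq_trans (card_left_others j); apply/subset_leq_card/subsetP => i.
  by rewrite !inE => /andP[].
apply/subset_leq_card/subsetP => i; rewrite !inE => /and3P[iP ij h].
by rewrite iP; apply: left_lt => //; rewrite inE.
Qed.

End BasePoint.
End UpperBounds.

(** * Positions of the two letters in the defining word *)

(* Positions (from 0) of the k-th L and of the k-th R in [amax_word M m n], for
   D = M - m and k < n. *)
Definition posL D k := if k < D then k else k.*2.+1 - D.
Definition posR n D k := if k < n - D then D + k.*2 else n + k.

Lemma iotaDl_0 m n : iota m n = map (addn m) (iota 0 n).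
Proof. by rewrite -iotaDl addn0. Qed.

Lemma mask_alternate b a c :
  mask (flatten (nseq c [:: b; ~~ b])) (iota a c.*2) =
  [seq a + k.*2 + ~~ b | k <- iota 0 c].
Proof.
elim: c a => //= c IH a; rewrite (iotaDl 1 0) -map_comp.
have -> : [seq ((fun k => a + k.*2 + ~~ b) \o addn 1) k | k <- iota 0 c] =
    [seq a.+2 + k.*2 + ~~ b | k <- iota 0 c].
  by apply: eq_map => k /=; lia.
by rewrite -IH; case: {IH} b => /=; rewrite ?addn0 ?addn1.
Qed.

(** One statement serves both letters: b = [true] selects the L positions, and b = [false], the
    negated word, selects the R positions. *)
Lemma mask_blocks b D c :
  mask (nseq D b ++ flatten (nseq c [:: ~~ b; b]) ++ nseq D (~~ b))
    (iota 0 (D + c).*2) =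
  if b then iota 0 D ++ [seq D + k.*2 + 1 | k <- iota 0 c]
  else [seq D + k.*2 | k <- iota 0 c] ++ iota (D + c.*2) D.
Proof.
have -> : (D + c).*2 = D + (c.*2 + D) by lia.
have := mask_alternate (~~ b) D c; rewrite negbK => alt.
rewrite !iotaD mask_cat ?size_nseq ?size_iota // mask_cat; last first.
  by rewrite size_iota size_flatten /shape map_nseq sumn_nseq /= mulnC muln2.
rewrite alt; case: b {alt} => /=; rewrite mask_true ?size_iota // mask_false.
  by rewrite cats0.
by under eq_map do rewrite addn0.
Qed.

Lemma mask_amax_word M m n : m < M <= n ->
  mask (amax_word M m n) (iota 0 n.*2) = map (posL (M - m)) (iota 0 n).
Proof.
move=> hMn; rewrite /amax_word; set D := M - m.
have -> : n - M + m = n - D by lia.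
have nE : n = D + (n - D) by lia.
rewrite {2}nE (mask_blocks true) {2}nE iotaD map_cat; congr (_ ++ _).
  rewrite -[LHS]map_id; apply/eq_in_map => k.
  by rewrite mem_iota /posL => /andP[_ ->].
rewrite add0n (iotaDl_0 D) -map_comp; apply: eq_map => k.
by rewrite /posL /=; case: ltnP; lia.
Qed.

Lemma mask_negb_amax_word M m n : m < M <= n ->
  mask (map negb (amax_word M m n)) (iota 0 n.*2) =
  map (posR n (M - m)) (iota 0 n).
Proof.
move=> hMn; rewrite /amax_word; set D := M - m.
have -> : n - M + m = n - D by lia.
have nE : n = (n - D) + D by lia.
rewrite !map_cat map_flatten !map_nseq /=.
have -> : iota 0 n.*2 = iota 0 (D + (n - D)).*2 by congr iota; lia.
have -> : iota 0 n = iota 0 (n - D) ++ iota (n - D) D by rewrite -iotaD -nE.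
rewrite (mask_blocks false) map_cat; congr (_ ++ _).
  apply/eq_in_map => k.
  by rewrite mem_iota /posR => /andP[_ ->].
rewrite (iotaDl_0 (D + _)) (iotaDl_0 (n - D)) -map_comp.
apply: eq_map => k.
by rewrite /posR /=; case: ltnP; lia.
Qed.

(** Any sequence is the image of its index sequence under [nth], and masking commutes with maps; so
    positions need only be computed on [iota]. *)
Lemma nth_mask_iota (T : Type) (x0 : T) (pts : seq T) w f n k :
  mask w (iota 0 (size pts)) = map f (iota 0 n) -> k < n ->
  nth x0 (mask w pts) k = nth x0 pts (f k).
Proof.
move=> wE kn; rewrite -{1}(mkseq_nth x0 pts) /mkseq -map_mask wE -map_comp.
by rewrite (nth_map 0) ?size_iota // nth_iota.
Qed.

(** * Agreement numbers and edges of the extremal collection *)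

Section Amax.
Variables (R : realType) (M m n : nat).
Hypotheses (hmM : m < M) (hMn : M <= n).
Variables (s : circle R) (pts : (n.*2).-tuple (circle R)).
Hypothesis hpts : clockwise_from s pts.

Let D := M - m.
Let A := amax M m s pts.
Let X j := nth s pts j.
Let u := cwdist s.
Let idxL i := if i < m then n - m + i else i - m.

Let X_lt j k : j < n.*2 -> k < n.*2 -> (u (X j) < u (X k))%R = (j < k).
Proof.
have mono a b : a < b -> b < n.*2 -> (u (X a) < u (X b))%R.
  move=> ab bn.
  have tr : transitive (fun p q : circle R => u p < u q)%R.
    by move=> ? ? ?; apply: lt_trans.
  apply: (sorted_ltn_nth tr s hpts) => //; rewrite inE size_tuple //.
  exact: ltn_trans bn.
move=> jn kn; case: (ltngtP j k) => [jk|kj|->]; last by rewrite ltxx.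
  exact: mono.
by rewrite lt_gtF // mono.
Qed.

Let X_le j k : j < n.*2 -> k < n.*2 -> (u (X j) <= u (X k))%R = (j <= k).
Proof. by move=> jn kn; rewrite leNgt X_lt // -leqNgt. Qed.

Let X_inj j k : j < n.*2 -> k < n.*2 -> X j = X k -> j = k.
Proof.
move=> jn kn e; apply/eqP; rewrite eqn_leq -(X_le jn kn) -(X_le kn jn) e.
by rewrite lexx.
Qed.

Let posL_lt k : k < n -> posL D k < n.*2.
Proof. by rewrite /posL /D; case: ifP; lia. Qed.

Let posR_lt k : k < n -> posR n D k < n.*2.
Proof. by rewrite /posR /D; case: ifP; lia. Qed.

Let idxL_lt i : i < n -> idxL i < n.
Proof. by rewrite /idxL; case: ifP; lia. Qed.

Let amaxE i : A i = (X (posL D (idxL i)), X (posR n D i)).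
Proof.
have hM : m < M <= n by rewrite hmM.
have Lk k : k < n -> nth s (mask (amax_word M m n) pts) k = X (posL D k).
  by apply: nth_mask_iota; rewrite size_tuple mask_amax_word.
have Rk k : k < n -> nth s (mask (map negb (amax_word M m n)) pts) k = X (posR n D k).
  by apply: nth_mask_iota; rewrite size_tuple mask_negb_amax_word.
have := idxL_lt (ltn_ord i).
by rewrite /A /amax /idxL; case: ifP => _ hk; rewrite Lk ?Rk.
Qed.

Let amax_wrap i : (u (A i).2 < u (A i).1)%R = (i < m).
Proof.
rewrite amaxE /= X_lt ?posL_lt ?posR_lt ?idxL_lt //.
have := ltn_ord i; rewrite /posL /posR /idxL /D.
by case: (ltnP i m); do 2 case: ifP; lia.
Qed.

Let in_wrap (i : 'I_n) q : i < m ->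
  in_arc (A i) q = (u (A i).1 <= u q)%R || (u q <= u (A i).2)%R.
Proof. by move=> im; rewrite (in_arcE s) /= leNgt amax_wrap im. Qed.

Let in_flat (i : 'I_n) q : m <= i ->
  in_arc (A i) q = (u (A i).1 <= u q <= u (A i).2)%R.
Proof. by move=> im; rewrite (in_arcE s) /= leNgt amax_wrap ltnNge im. Qed.

Let posLR_neq a b : a < n -> b < n -> posL D a != posR n D b.
Proof. by rewrite /posL /posR /D; do 2 case: ifP; lia. Qed.

Let posL_inj a b : a < n -> b < n -> posL D a = posL D b -> a = b.
Proof. by rewrite /posL /D; do 2 case: ifP; lia. Qed.

Let posR_inj a b : a < n -> b < n -> posR n D a = posR n D b -> a = b.
Proof. by rewrite /posR /D; do 2 case: ifP; lia. Qed.

Let idxL_inj a b : a < n -> b < n -> idxL a = idxL b -> a = b.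
Proof. by rewrite /idxL; do 2 case: ifP; lia. Qed.

Lemma amax_uniq : uniq (endpoints A).
Proof.
rewrite /endpoints cat_uniq; apply/and3P; split.
- apply/(@injectiveP _ _ (fun i => (A i).1)) => i j; rewrite !amaxE /= => /X_inj.
  move=> /(_ (posL_lt (idxL_lt (ltn_ord i))) (posL_lt (idxL_lt (ltn_ord j)))) e.
  by apply/val_inj/(idxL_inj (ltn_ord i) (ltn_ord j))/(posL_inj _ _ e); apply: idxL_lt.
- apply/hasPn => q /mapP[j _ ->]; apply/mapP => -[i _]; rewrite !amaxE /= => e.
  have := posLR_neq (idxL_lt (ltn_ord i)) (ltn_ord j).
  by rewrite (X_inj _ _ e) ?eqxx ?posL_lt ?posR_lt ?idxL_lt.
- apply/(@injectiveP _ _ (fun i => (A i).2)) => i j; rewrite !amaxE /= => /X_inj.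
  move=> /(_ (posR_lt (ltn_ord i)) (posR_lt (ltn_ord j))) e.
  exact/val_inj/(posR_inj (ltn_ord i) (ltn_ord j) e).
Qed.

Let sum_idxL (F : nat -> nat) : \sum_(i < n) F (idxL i) = \sum_(k < n) F k.
Proof.
have mn : m <= n by lia.
have nmn : n - m <= n by lia.
rewrite -(big_mkord xpredT (fun i => F (idxL i))) -(big_mkord xpredT F).
rewrite (big_cat_nat (leq0n m) mn) //= [RHS](big_cat_nat (leq0n _) nmn) //= addnC.
congr (_ + _).
  rewrite -{1}(add0n m) big_addn; apply: eq_big_nat => i _.
  by rewrite /idxL ltnNge leq_addl /= addnK.
rewrite -(add0n (n - m)) big_addn subKn //; apply: eq_big_nat => i /andP[_ im].
by rewrite /idxL im addnC.
Qed.

(** Exactly m arcs wrap around s, and the cyclic shift [idxL] permutes the left endpoints. Hence the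
    agreement at q is read off the word: m, plus the L's up to q, minus the R's strictly before
    q. *)
Let agreement_amax q :
  agreement A q + \sum_(k < n) (u (X (posR n D k)) < u q)%R =
  m + \sum_(k < n) (u (X (posL D k)) <= u q)%R.
Proof.
have := agreement_balance A s q.
under eq_bigr do rewrite amaxE; move=> ->; congr (_ + _).
  under eq_bigr do rewrite amax_wrap.
  have mn : m <= n by lia.
  rewrite -(big_mkord xpredT (fun i => nat_of_bool (i < m)))
    (big_cat_nat (leq0n m) mn) //=.
  rewrite (eq_big_nat _ _ (F2 := fun=> 1)); last by move=> i /andP[_ ->].
  rewrite [X in _ + X]big1_seq ?addn0 ?sum_nat_const_nat ?subn0 ?muln1 //.
  by move=> i /=; rewrite mem_index_iota => /andP[mi _]; rewrite ltnNge mi.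
under eq_bigr do rewrite amaxE.
exact: (sum_idxL (fun k => (u (X (posL D k)) <= u q)%R)).
Qed.

(** In each block RL, the L numbered k + D directly follows the R numbered k, so only the first D =
    M - m L's can be in excess. *)
Lemma amax_agreement_le q : agreement A q <= M.
Proof.
rewrite -(leq_add2r (\sum_(k < n) (u (X (posR n D k)) < u q)%R)) agreement_amax.
have -> : M = m + D by rewrite /D; lia.
rewrite -addnA leq_add2l.
have Dn : D <= n by rewrite /D; lia.
rewrite -(big_mkord xpredT (fun k => nat_of_bool (u (X (posL D k)) <= u q)%R)).
rewrite -(big_mkord xpredT (fun k => nat_of_bool (u (X (posR n D k)) < u q)%R)).
rewrite (big_cat_nat (leq0n _) Dn) //=; apply: leq_add.
  rewrite -{3}(subn0 D) -[D - 0]muln1 -sum_nat_const_nat.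
  by apply: leq_sum => k _; case: (_ <= _)%R.
have nDn : n - D <= n by lia.
rewrite -{1}(add0n D) big_addn (big_cat_nat (leq0n _) nDn) //=.
apply: leq_trans (leq_addr _ _).
rewrite !big_nat; apply: leq_sum => k /andP[_ kn].
case h: (_ <= _)%R => //; rewrite (lt_le_trans _ h) //.
rewrite X_lt ?posL_lt ?posR_lt //; try lia.
by rewrite /posL /posR; do 2 case: ifP; lia.
Qed.

(** The k-th R comes after the k-th L, so the R's passed never outnumber the L's. *)
Lemma amax_agreement_ge q : m <= agreement A q.
Proof.
rewrite -(leq_add2r (\sum_(k < n) (u (X (posR n D k)) < u q)%R)) agreement_amax.
rewrite leq_add2l; apply: leq_sum => k _.
case h: (_ < u q)%R => //; rewrite (le_trans _ (ltW h)) //.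
rewrite X_le ?posL_lt ?posR_lt //.
by have := ltn_ord k; rewrite /posL /posR; do 2 case: ifP; lia.
Qed.

Lemma amax_agreement_max : exists q, agreement A q = M.
Proof.
have Dn : 0 < D <= n by rewrite /D; lia.
(* The last point of the initial run of L's: D L's have been met and no R. *)
exists (X D.-1); apply/eqP; rewrite eqn_leq amax_agreement_le /=.
have := agreement_amax (X D.-1); rewrite [X in _ + X]big1 ?addn0 => [->|k _].
  rewrite -[M](subnKC (ltnW hmM)) leq_add2l -/D.
  rewrite -[X in X <= _]card_ord -sum1_card.
  rewrite (big_ord_widen n (fun=> 1)) ?big_mkcond; last by lia.
  apply: leq_sum => k _; case: ifP => // kD; rewrite X_le ?posL_lt //; try lia.
  by rewrite /posL kD; lia.
rewrite X_lt ?posR_lt //; last by lia.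
by have := ltn_ord k; rewrite /posR; case: ifP; lia.
Qed.

Lemma amax_agreement_min : exists q, agreement A q = m.
Proof.
have n0 : 0 < n by lia.
have u1 := cwdist_lt1 s (X n.*2.-1); have u0 := cwdist_ge0 s (X n.*2.-1).
rewrite -/u in u0 u1.
(* A point strictly between the last endpoint and the return to s, where all L's and R's cancel. The
   point s itself would not do in general, since it may be the first L. *)
have [|q uq] := @cwdist_surj R s ((u (X n.*2.-1) + 1) / 2)%R; first by lra.
have ltq j : j < n.*2 -> (u (X j) < u q)%R.
  move=> jn; apply: (@le_lt_trans _ _ (u (X n.*2.-1))); last by rewrite /u uq -/u; lra.
  by rewrite X_le; lia.
exists q; have := agreement_amax q.
rewrite (eq_bigr (fun=> 1)) => [|k _]; last by rewrite ltq ?posR_lt.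
rewrite [X in _ = _ + X](eq_bigr (fun=> 1)) => [|k _]; last by rewrite ltW ?ltq ?posL_lt.
exact: addIn.
Qed.

Lemma amax_satisfies : satisfies M m A.
Proof.
split; first exact: amax_uniq.
  by split; [exact: amax_agreement_le|exact: amax_agreement_max].
by split; [exact: amax_agreement_ge|exact: amax_agreement_min].
Qed.

(** Counting from 0, the L numbered k precedes the R numbered l exactly when k < l + D. After the
    shift by m, the condition j < i + M puts the left endpoint of [A j] in [A i] unless both arcs
    wrap, and i + n < j + M puts that of a wrapping [A i] in a non-wrapping [A j]. Two wrapping arcs
    meet at s. *)
Lemma amax_intersect (i j : 'I_n) : i < j ->
  (j < i + M) || (i < m) && (i + n < j + M) -> intersect (A i) (A j).
Proof.
move=> ij; have jn := ltn_ord j; case: (ltnP i m) => im; last first.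
  rewrite orbF => jM; exists (A j).1; split; last exact: in_arc_left.
  rewrite in_flat // !amaxE /= !X_le ?posL_lt ?posR_lt ?idxL_lt //.
  by rewrite /posL /posR /idxL /D; do 2 case: (ltnP _ m); do 3 case: ifP; lia.
case: (ltnP j m) => jm.
  move=> _; exists s; rewrite !in_wrap // /u cwdistxx.
  by rewrite !(cwdist_ge0 s (A _).2) !orbT.
case/orP => /= h.
  exists (A j).1; split; last exact: in_arc_left.
  rewrite in_wrap //; apply/orP; right.
  rewrite !amaxE /= !X_le ?posL_lt ?posR_lt ?idxL_lt //.
  by rewrite /posL /posR /idxL /D (leq_gtF jm); do 2 case: ifP; lia.
exists (A i).1; split; first exact: in_arc_left.
rewrite in_flat // !amaxE /= !X_le ?posL_lt ?posR_lt ?idxL_lt //.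
by rewrite /posL /posR /idxL /D im (leq_gtF jm); do 3 case: ifP; lia.
Qed.

(** Each edge is counted at its smaller index; the sum is cut at m because wrapping arcs have a
    different count. *)
Let edge_count_ge (d : nat -> nat) :
    (forall i : 'I_n,
      d i <= #|[set j : 'I_n | (i < j) && `[< intersect (A i) (A j) >]]|) ->
  \sum_(0 <= i < m) d i + \sum_(m <= i < n) d i <= edge_count A.
Proof.
move=> dle; have mn : m <= n by lia.
rewrite -(big_cat_nat (leq0n m) mn) //= big_mkord.
rewrite /edge_count.
rewrite (card_pairs_sum (fun i j : 'I_n => (i < j) && `[< intersect (A i) (A j) >])).
exact: leq_sum.
Qed.

Let near_le (i : 'I_n) : minn M.-1 (n.-1 - i) <=
  #|[set j : 'I_n | (i < j) && `[< intersect (A i) (A j) >]]|.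
Proof.
rewrite (_ : minn _ _ = minn n (i + M) - i.+1); last by lia.
rewrite -(card_ord_interval _ (geq_minl _ _)).
apply/subset_leq_card/subsetP => j; rewrite !inE leq_min => /and3P[ij _ jM].
by rewrite ij; apply/asboolP/amax_intersect => //; rewrite jM.
Qed.

Let sum_tail : \sum_(m <= i < n) minn M.-1 (n.-1 - i) = \sum_(k < n - m) minn M.-1 k.
Proof.
rewrite big_nat_rev -{1}(add0n m) big_addn big_mkord.
by apply: eq_bigr => k _; congr minn; have := ltn_ord k; lia.
Qed.

Lemma amax_edge_count_dense : n < M.*2 ->
  \sum_(k < m) k + \sum_(k < n - m) (m + minn M.-1 k) <= edge_count A.
Proof.
move=> nM; pose d i := if i < m then n.-1 - i else minn M.-1 (n.-1 - i).
apply: leq_trans (edge_count_ge (d := d) _); last first.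
  move=> i; rewrite /d; case: ltnP => im; last exact: near_le.
  have -> : n.-1 - i = n - i.+1 by lia.
  rewrite -(card_ord_interval _ (leqnn n)).
  apply/subset_leq_card/subsetP => j; rewrite !inE => /andP[ij _].
  (* A wrapping arc meets every later arc: if j >= i + M, then j + M >= i + 2M > i + n. *)
  by rewrite ij; apply/asboolP/amax_intersect => //; rewrite im /=; lia.
rewrite [X in _ <= X + _](eq_big_nat _ _ (F2 := fun i => n.-1 - i)); last first.
  by move=> i /andP[_ im]; rewrite /d im.
rewrite [X in _ <= _ + X](eq_big_nat _ _ (F2 := fun i => minn M.-1 (n.-1 - i))); last first.
  by move=> i /andP[im _]; rewrite /d ltnNge im.
(* Reversing the first m indices turns n - 1 - i into (n - m) + k; the constant parts add up to m(n
   - m), which is the sum of the terms m on the other side. *)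
rewrite sum_tail big_nat_rev big_mkord big_split /= addnA leq_add2r.
rewrite sum_nat_const card_ord mulnC -[m in m * _]card_ord -sum_nat_const -big_split /=.
by apply: leq_sum => k _; have := ltn_ord k; lia.
Qed.

Lemma amax_edge_count_sparse : M.*2 <= n ->
  m * M.-1 + \sum_(k < n - m) minn M.-1 (m + k) <= edge_count A.
Proof.
move=> nM; pose d i := if i < m then M.-1 + (M.-1 - i) else minn M.-1 (n.-1 - i).
apply: leq_trans (edge_count_ge (d := d) _); last first.
  move=> i; rewrite /d; case: ltnP => im; last exact: near_le.
  have iMn : i + M <= n by lia.
  (* The neighbours i < j < i + M and i + n - M < j < n of a wrapping arc form two intervals,
     disjoint because 2M <= n. *)
  rewrite (_ : _ + _ = (i + M - i.+1) + (n - (i + n - M).+1)); last by lia.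
  rewrite -(card_ord_interval _ iMn) -(card_ord_interval _ (leqnn n)) -cardsUI.
  rewrite [X in _ + #|pred_of_set X|](_ : _ = set0) ?cards0 ?addn0; last first.
    by apply/setP => j; rewrite !inE; lia.
  apply/subset_leq_card/subsetP => j; rewrite !inE => ij.
  have -> : i < j by lia.
  by apply/asboolP/amax_intersect; rewrite ?im; lia.
rewrite [X in _ <= X + _](eq_big_nat _ _ (F2 := fun i => M.-1 + (M.-1 - i))); last first.
  by move=> i /andP[_ im]; rewrite /d im.
rewrite [X in _ <= _ + X](eq_big_nat _ _ (F2 := fun i => minn M.-1 (n.-1 - i))); last first.
  by move=> i /andP[im _]; rewrite /d ltnNge im.
rewrite sum_tail big_mkord big_split /= sum_nat_const card_ord -addnA leq_add2l.
(* The second intervals, of sizes M - 1 - i for i < m, make up for the shift by m inside the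
   minimum. *)
by apply: sum_min_shift; lia.
Qed.

End Amax.

Theorem theorem12 (R : realType) (M m n : nat) (hmM : (m < M)%N)
    (hMn : (M <= n)%N) (s : circle R) (pts : (n.*2).-tuple (circle R))
    (hpts : clockwise_from s pts) :
  satisfies M m (amax M m s pts) /\
  (forall B : collection R n, satisfies M m B ->
     (edge_count B <= edge_count (amax M m s pts))%N).
Proof.
split=> [|B satB]; first exact: amax_satisfies.
case: (satB) => _ _ [_ [p agrp]]; case: (leqP M.*2 n) => nM.
  exact: leq_trans (edge_count_le_sparse satB agrp) (amax_edge_count_sparse _ _ _ _).
exact: leq_trans (edge_count_le_dense satB agrp) (amax_edge_count_dense _ _ _ _).
Qed.
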